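(* Let $G$ be a graph such that every biconnected component of $G$ is either a cycle graph or has at most four vertices (i.e. for every $H\in\mathbb B(G)$: $H\cong K_2$ or $H\cong D$ or $H\cong K_4$ or $H\cong C_n$ for some $n=n(H)\ge3$). Then $G$ satisfies the strong bunkbed conjecture.
   Context: All graphs are finite and simple; an edge between $v$ and $w$ is written $vw=\{v,w\}$. Bunkbed graph: for a graph $G$, $B(G)$ has vertex set $V(G)\times\{0,1\}$; write $v_i=(v,i)$ and, for $e=xy\in E(G)$, $e_i=x_iy_i$. Its edges are the horizontal edges $e_i$ ($e\in E(G)$, $i\in\{0,1\}$) and the posts $v_0v_1$ ($v\in V(G)$). Percolation: for $T\subseteq V(G)$ and $\vec p=(p_e)_{e\in E(G)}\in[0,1]^{E(G)}$, $B^T=B^T(G,\vec p)$ is the random subgraph of $B(G)$ containing all vertices of $B(G)$, in which each horizontal edge $e_i$ is present with probability $p_e$, independently of all other horizontal edges, and each post $v_0v_1$ is deterministically present if and only if $v\in T$. Write $a\overset{B^T}{\longleftrightarrow}b$ if there is a path between $a$ and $b$ in $B^T$. For $v,w\in V(G)$, $\mathscr B(G,T,\vec p,v,w)$ denotes the statement $\mathbb P(v_0\overset{B^T}{\longleftrightarrow}w_0)\ge\mathbb P(v_0\overset{B^T}{\longleftrightarrow}w_1)$. $G$ satisfies the strong bunkbed conjecture if $\mathscr B(G,T,\vec p,v,w)$ holds for all $T\subseteq V(G)$, $\vec p\in[0,1]^{E(G)}$, $v,w\in V(G)$. Blocks: a graph $H$ is biconnected if $|V(H)|\ge2$, $H$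 is connected, and $H\setminus x$ (delete $x$ and all incident edges) is connected for every $x\in V(H)$; in particular $K_2$ is biconnected. A biconnected component (block) of $G$ is a subgraph of $G$ that is maximal (with respect to the subgraph relation) among the biconnected subgraphs of $G$. $\mathbb B(G)$ is the set of blocks of $G$. The diamond graph $D$ is $K_4$ with one edge deleted. *)

(* Defs.v *)
From HB Require Import structures.
From mathcomp Require Import all_boot all_order all_algebra.
From mathcomp Require Import reals.

Set Implicit Arguments.
Unset Strict Implicit.
Unset Printing Implicit Defensive.

Import Order.TTheory GRing.Theory Num.Theory.

(* A finite simple graph whose vertices are drawn from the finite type U; the
   vertex set need not be all of U, so a subgraph has the same type as its
   ambient graph. *)
Record graph (U : finType) := Graph {
  vset : {set U};
  eset : {set {set U}};
  graph_wf : [forall e in eset, (e \subset vset) && (#|e| == 2)]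
}.

Definition adj (U : finType) (H : graph U) : rel U :=
  fun x y => [set x; y] \in eset H.

Definition subgraph (U : finType) (H K : graph U) : bool :=
  (vset H \subset vset K) && (eset H \subset eset K).

Definition connected (U : finType) (H : graph U) : Prop :=
  forall x y, x \in vset H -> y \in vset H -> connect (adj H) x y.

Fact del_vertex_wf (U : finType) (H : graph U) (x : U) :
  [forall e in [set f in eset H | x \notin f],
     (e \subset vset H :\ x) && (#|e| == 2)].
Proof.
apply/forall_inP => e; rewrite inE => /andP[eH xe].
by have /andP[sub ->] := forall_inP (graph_wf H) _ eH; rewrite subsetD1 sub xe.
Qed.

Definition del_vertex (U : finType) (H : graph U) (x : U) : graph U :=
  Graph (del_vertex_wf H x).

Definition biconnected (U : finType) (H : graph U) : Prop :=
  [/\ 2 <= #|vset H|,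
      connected H &
      forall x, x \in vset H -> connected (del_vertex H x)].

Definition is_block (U : finType) (G H : graph U) : Prop :=
  [/\ subgraph H G,
      biconnected H &
      forall K : graph U,
        subgraph K G -> biconnected K -> subgraph H K -> K = H].

Definition graph_iso (U W : finType) (H : graph U) (K : graph W) : Prop :=
  exists f : U -> W,
    [/\ {in vset H &, injective f},
        f @: vset H = vset K &
        {in vset H &, forall x y, adj H x y = adj K (f x) (f y)}].

Fact cycle_graph_wf (n : nat) :
  [forall e in [set [set i; ordS i] | i : 'I_n & ordS i != i],
     (e \subset [set: 'I_n]) && (#|e| == 2)].
Proof.
apply/forall_inP => e /imsetP[i ne ->].
move: ne; rewrite !inE => ne.
by rewrite subsetT cards2 (eq_sym i) ne.
Qed.

(* C_n for n >= 3; [ordS i] is i + 1 modulo n. The filter only matters for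
   n = 1, where i = i + 1. *)
Definition cycle_graph (n : nat) : graph 'I_n := Graph (cycle_graph_wf n).

Definition is_cycle_graph (U : finType) (H : graph U) : Prop :=
  exists2 n, 3 <= n & graph_iso H (cycle_graph n).

(* The levels 0 and 1 are [false] and [true]. *)
Definition hedge (U : finType) (e : {set U}) (i : bool) : {set U * bool} :=
  [set (x, i) | x in e].

Definition post (U : finType) (v : U) : {set U * bool} :=
  [set (v, false); (v, true)].

Fact bunkbed_wf (U : finType) (G : graph U) :
  [forall e in [set hedge f i | f in eset G, i in [set: bool]]
                 :|: [set post v | v in vset G],
     (e \subset setX (vset G) [set: bool]) && (#|e| == 2)].
Proof.
apply/forall_inP => e; rewrite inE => /orP[/imset2P[f i fG _ ->]|].
  have /andP[/subsetP sub f2] := forall_inP (graph_wf G) _ fG.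
  rewrite card_imset ?f2 ?andbT; last by move=> x y [].
  by apply/subsetP => _ /imsetP[x xf ->]; rewrite !inE /= sub.
move=> /imsetP[v vG ->]; rewrite cards2 xpair_eqE andbF andbT.
by apply/subsetP => x; rewrite !inE => /orP[]/eqP->; rewrite /= vG.
Qed.

Definition bunkbed (U : finType) (G : graph U) : graph (U * bool)%type :=
  Graph (bunkbed_wf G).

Fact spanning_wf (U : finType) (H : graph U) (F : {set {set U}}) :
  [forall e in eset H :&: F, (e \subset vset H) && (#|e| == 2)].
Proof.
apply/forall_inP => e; rewrite inE => /andP[eH _].
exact: (forall_inP (graph_wf H)).
Qed.

Definition spanning (U : finType) (H : graph U) (F : {set {set U}}) : graph U :=
  Graph (spanning_wf H F).

(* Sample space of the percolation: an outcome is the set of those pairs (e, i)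
   for which the horizontal edge e_i is present. *)
Definition outcomes (U : finType) (G : graph U) : {set {set {set U} * bool}} :=
  powerset (setX (eset G) [set: bool]).

Definition percolation (U : finType) (G : graph U) (T : {set U})
    (omega : {set {set U} * bool}) : graph (U * bool)%type :=
  spanning (bunkbed G)
    ([set hedge f.1 f.2 | f in omega] :|: [set post v | v in T]).

Local Open Scope ring_scope.

Definition outcome_weight (R : realType) (U : finType) (G : graph U)
    (p : {set U} -> R) (omega : {set {set U} * bool}) : R :=
  \prod_(f in setX (eset G) [set: bool])
    (if f \in omega then p f.1 else 1 - p f.1).

Definition prob (R : realType) (U : finType) (G : graph U)
    (p : {set U} -> R) (A : pred {set {set U} * bool}) : R :=
  \sum_(omega in outcomes G | A omega) outcome_weight G p omega.

Definition bunkbed_ineq (R : realType) (U : finType) (G : graph U)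
    (T : {set U}) (p : {set U} -> R) (v w : U) : Prop :=
  prob G p (fun omega =>
              connect (adj (percolation G T omega)) (v, false) (w, false))
  >= prob G p (fun omega =>
              connect (adj (percolation G T omega)) (v, false) (w, true)).

(* Only the values of p on the edges of G matter. *)
Definition strong_bunkbed (R : realType) (U : finType) (G : graph U) : Prop :=
  forall (T : {set U}) (p : {set U} -> R) (v w : U),
    T \subset vset G ->
    (forall e, e \in eset G -> 0 <= p e <= 1) ->
    v \in vset G -> w \in vset G ->
    bunkbed_ineq G T p v w.

(* Main.v *)
Require Import Defs.
From mathcomp Require Import all_boot all_order all_algebra.
From mathcomp Require Import reals.
From mathcomp Require Import zify ring.

Set Implicit Arguments.
Unset Strict Implicit.
Unset Printing Implicit Defensive.

(* Write f for the expectation of [v_0 ~ w_0] - [v_0 ~ w_1]; f >= 0 is to be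
   shown. Exchanging the two levels of all edges in a fixed set preserves the
   distribution; if T separates v from w, exchanging levels on the side of w
   gives f = 0.

   If G is the union of G1 and G2 sharing one vertex c, condition on one side.
   When v and w lie on the same side, the other side only decides whether c
   becomes a post. When they lie on different sides, f is the product of the
   corresponding quantities for (v, c) in G1 and (c, w) in G2. This reduces the
   claim to blocks.

   In a cycle, let P and Q be the arcs between v and w. If both meet T, then T
   separates v from w. If Q avoids T, condition on Q: when Q is open on neither
   level, exchanging levels on P between a post and w shows that f vanishes (if
   there is no post at all, v_0 is not connected to w_1); when it is open on
   some level, [v_0 ~ w_0] - [v_0 ~ w_1] plus its image under the global exchange of
   levels is pointwise nonnegative.

   On at most four vertices, condition for each edge e on whether e_0, e_1 are
   both present, both absent, or exactly one is present. In the last case each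
   is present with conditional probability 1/2, so the claim becomes finitely
   many inequalities between cardinalities, which are checked by computation. *)

Import Order.TTheory GRing.Theory Num.Theory.
Local Open Scope ring_scope.

(** * Bernoulli expectations *)

Lemma set_ind (K : finType) (P : {set K} -> Prop) :
    P set0 -> (forall x (A : {set K}), x \notin A -> P A -> P (x |: A)) ->
  forall A, P A.
Proof.
move=> P0 PU A; have [n] := ubnP #|A|; elim: n A => // n IHn A.
have [->//|[x xA]] := set_0Vmem A.
rewrite (cardsD1 x) xA ltnS => ltAn; rewrite -(setD1K xA).
by apply: PU (IHn _ ltAn); rewrite !inE eqxx.
Qed.

Section BernoulliExpectation.
Variables (R : realType) (K : finType).
Implicit Types (A B : {set K}) (q : K -> R) (F : {set K} -> R).

Definition bweight A q (s : {set K}) : R :=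
  \prod_(f in A) (if f \in s then q f else 1 - q f).

(** Expectation of [F] at the random subset of [A] that contains each [x] independently with
    probability [q x]. *)
Definition bexp A q F : R := \sum_(s in powerset A) bweight A q s * F s.

Lemma eq_bexp A q q' F F' :
    {in A, q =1 q'} -> (forall s : {set K}, s \subset A -> F s = F' s) ->
  bexp A q F = bexp A q' F'.
Proof.
move=> eq_q eqF; apply: eq_bigr => s; rewrite inE => sA.
by rewrite eqF //; congr (_ * _); apply: eq_bigr => f /eq_q->.
Qed.

Lemma bexp_ge0 A q F :
    {in A, forall x, 0 <= q x <= 1} ->
    (forall s : {set K}, s \subset A -> 0 <= F s) ->
  0 <= bexp A q F.
Proof.
move=> q01 F0; apply: sumr_ge0 => s; rewrite inE => sA.
apply: mulr_ge0 (F0 s sA); apply: prodr_ge0 => x /q01/andP[q0 q1].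
by case: ifP; rewrite ?subr_ge0.
Qed.

Lemma bexpD A q F F' :
  bexp A q (fun s => F s + F' s) = bexp A q F + bexp A q F'.
Proof. by rewrite -big_split; apply: eq_bigr => s _; rewrite mulrDr. Qed.

Lemma bexpZ A q a F : bexp A q (fun s => a * F s) = a * bexp A q F.
Proof. by rewrite mulr_sumr; apply: eq_bigr => s _; rewrite mulrCA. Qed.

Lemma bexpB A q F F' :
  bexp A q (fun s => F s - F' s) = bexp A q F - bexp A q F'.
Proof.
rewrite -[- bexp A q F']mulN1r -bexpZ -bexpD.
by apply: eq_bexp => // s _; rewrite mulN1r.
Qed.

Lemma bexp0 q F : bexp set0 q F = F set0.
Proof. by rewrite /bexp powerset0 big_set1 /bweight big_set0 mul1r. Qed.

(** Conditioning on whether [x] is drawn. With [bexp0] it drives the inductions on [A] below. *)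
Lemma bexpU1 A q F x : x \notin A ->
  bexp (x |: A) q F =
    q x * bexp A q (fun s => F (x |: s)) + (1 - q x) * bexp A q F.
Proof.
move=> xA; have sub_xN (s : {set K}) : s \subset A -> x \notin s.
  by move=> /subsetP sA; apply: contra xA; apply: sA.
rewrite /bexp (bigID [pred s : {set K} | x \in s]) /=; congr (_ + _).
  rewrite (reindex_onto (fun s => x |: s) (fun s => s :\ x)) /=; last first.
    by move=> s /andP[_ xs]; rewrite setD1K.
  rewrite mulr_sumr; apply: eq_big => [s|s].
    rewrite !inE eqxx andbT; apply/andP/idP => [[sA /eqP<-]|sA].
      by rewrite subDset.
    by rewrite setUS ?setU1K ?sub_xN.
  rewrite !inE eqxx andbT => /andP[sA /eqP Ds].
  rewrite mulrA; congr (_ * _).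
  rewrite /bweight big_setU1 //= setU11; congr (_ * _).
  apply: eq_bigr => f fA; rewrite !inE.
  by case: eqP fA xA => // -> ->.
rewrite mulr_sumr; apply: eq_big => [s|s].
  rewrite !inE; apply/andP/idP => [[sA xs]|sA].
    apply/subsetP => y ys; have := subsetP sA y ys; rewrite !inE.
    by case: eqP ys xs => // -> ->.
  by rewrite sub_xN // (subset_trans sA) ?subsetU1.
rewrite !inE => /andP[sA /negPf xs]; rewrite mulrA; congr (_ * _).
by rewrite /bweight big_setU1 //= xs.
Qed.

Lemma bexpU A B q F : [disjoint A & B] ->
  bexp (A :|: B) q F = bexp A q (fun s => bexp B q (fun t => F (s :|: t))).
Proof.
elim/set_ind: A F => [|x A xA IHA] F.
  by move=> _; rewrite set0U bexp0; apply: eq_bexp => // s _; rewrite set0U.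
rewrite disjoints_subset subUset sub1set inE -disjoints_subset => /andP[xB dAB].
rewrite -setUA !bexpU1 ?inE ?negb_or ?xA // !IHA //.
congr (_ * _ + _); apply: eq_bexp => // s _; apply: eq_bexp => // t _.
by rewrite setUA.
Qed.

Lemma bexp_q0 A q F : {in A, forall x, q x = 0} -> bexp A q F = F set0.
Proof.
elim/set_ind: A F => [|x A xA IHA] F q0; first exact: bexp0.
rewrite bexpU1 // q0 ?setU11 // mul0r add0r subr0 mul1r.
by apply: IHA => y yA; rewrite q0 // setU1r.
Qed.

(** Elements of probability 0 are almost surely absent. This is what later lets a graph be completed
    by edges of probability 0. *)
Lemma bexp_ext A B q F : A \subset B -> {in B :\: A, forall x, q x = 0} ->
  bexp B q F = bexp A q F.
Proof.
move=> sAB q0; rewrite -[in LHS](setID B A) (setIidPr sAB) bexpU; last first.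
  by rewrite disjoints_subset; apply/subsetP => x xA; rewrite !inE xA.
by apply: eq_bexp => // s _; rewrite bexp_q0 // setU0.
Qed.

End BernoulliExpectation.

Lemma bexp_imset (R : realType) (K K' : finType) (h : K -> K') (A : {set K})
    (q : K' -> R) F : injective h ->
  bexp (h @: A) q F = bexp A (q \o h) (fun s => F (h @: s)).
Proof.
move=> h_inj; elim/set_ind: A F => [|x A xA IHA] F.
  by rewrite imset0 !bexp0 imset0.
rewrite imsetU1 !bexpU1 ?mem_imset // !IHA; congr (_ * _ + _).
by apply: eq_bexp => // s _; rewrite imsetU1.
Qed.

(** * Connectivity in the bunkbed graph *)

Lemma connect_ind (V : finType) (e : rel V) (P : V -> Prop) (a b : V) :
    P a -> (forall x y, P x -> e x y -> P y) -> connect e a b -> P b.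
Proof.
move=> Pa Pe /connectP[s es ->]; elim: s a Pa es => //= c s IHs a Pa /andP[eac].
exact: IHs (Pe _ _ Pa eac).
Qed.

Lemma connect_homo (V W : finType) (e : rel V) (e' : rel W) (h : V -> W) :
    (forall x y, e x y -> connect e' (h x) (h y)) ->
  forall x y, connect e x y -> connect e' (h x) (h y).
Proof.
move=> he x y.
apply: (@connect_ind _ _ (fun z => connect e' (h x) (h z))) => //.
by move=> z t xz /he; apply: connect_trans.
Qed.

Section Bunkbed.
Variable U : finType.
Implicit Types (T : {set U}) (e : {set U}) (E F : {set {set U}}).
Implicit Types (w : {set {set U} * bool}) (x y v u : U) (i j : bool).

(** Adjacency of the percolated bunkbed graph, written directly on the set [w] of present horizontal
    edges, so that unions and level exchanges act on [w] alone. The post clause allows equal levels,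
    which only adds loops. *)
Definition bb T w : rel (U * bool) := fun a b =>
  (a.2 == b.2) && (([set a.1; b.1], a.2) \in w) || (a.1 == b.1) && (a.1 \in T).

Lemma bb_sym T w : symmetric (bb T w).
Proof.
move=> [x i] [y j]; rewrite /bb /= (setUC [set x]) (eq_sym i) (eq_sym x).
by case: (j =P i) => [->|_]; case: (y =P x) => [->|_].
Qed.

Lemma bb_connect_sym T w : connect_sym (bb T w).
Proof. by apply: sym_connect_sym; apply: bb_sym. Qed.

Lemma bb_edge T w x y i :
  ([set x; y], i) \in w -> connect (bb T w) (x, i) (y, i).
Proof. by move=> xyw; apply: connect1; rewrite /bb /= eqxx xyw. Qed.

Lemma bb_post T w x i j : x \in T -> connect (bb T w) (x, i) (x, j).
Proof. by move=> xT; apply: connect1; rewrite /bb /= eqxx xT orbT. Qed.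

Lemma bb_ind T w (P : U * bool -> Prop) a b :
    P a ->
    (forall x y i, P (x, i) -> ([set x; y], i) \in w -> P (y, i)) ->
    (forall x i j, P (x, i) -> x \in T -> P (x, j)) ->
  connect (bb T w) a b -> P b.
Proof.
move=> Pa Pw PT; apply: connect_ind Pa _ => -[x i] [y j] Px /=.
by case/orP=> /= /andP[/eqP eq]; rewrite -eq; [apply: Pw Px|apply: PT Px].
Qed.

Lemma bb_homo T w (W : finType) (e' : rel W) (h : U * bool -> W) a b :
    (forall x y i, ([set x; y], i) \in w -> connect e' (h (x, i)) (h (y, i))) ->
    (forall x i j, x \in T -> connect e' (h (x, i)) (h (x, j))) ->
  connect (bb T w) a b -> connect e' (h a) (h b).
Proof.
move=> hw hT; apply: connect_homo => -[x i] [y j].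
by case/orP=> /= /andP[/eqP eq]; rewrite -eq; [apply: hw|apply: hT].
Qed.

Definition flip F (f : {set U} * bool) := (f.1, f.2 (+) (f.1 \in F)).

Lemma flipK F : involutive (flip F).
Proof. by move=> [e i]; rewrite /flip /= addbK. Qed.

Lemma flip_imsetK F : involutive (fun w => flip F @: w).
Proof.
move=> w; rewrite -imset_comp -[RHS]imset_id.
by apply: eq_imset => f; apply: flipK.
Qed.

Lemma mem_flip F w e i :
  ((e, i) \in flip F @: w) = ((e, i (+) (e \in F)) \in w).
Proof.
rewrite -[in RHS](mem_imset _ _ (inv_inj (flipK F))) /flip /=.
by rewrite addbK.
Qed.

Lemma flip_sub F E w : w \subset setX E [set: bool] ->
  flip F @: w \subset setX E [set: bool].
Proof.
move/subsetP=> wE; apply/subsetP => -[e i]; rewrite mem_flip => /wE.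
by rewrite !inE.
Qed.

(** Exchanging levels on the edges in [F] and on the vertices with [s] is an isomorphism up to
    posts: an edge and its endpoint may disagree only at a vertex of [T], whose two copies are
    joined anyway. *)
Lemma flip_connect E F T w (s : U -> bool) x y i j :
    (forall e z, e \in E -> z \in e -> (s z == (e \in F)) || (z \in T)) ->
    w \subset setX E [set: bool] ->
  connect (bb T (flip F @: w)) (x, i (+) s x) (y, j (+) s y) =
    connect (bb T w) (x, i) (y, j).
Proof.
(* One implication is enough, since the exchange is an involution on outcomes. *)
move=> sF; have impl w' a b : w' \subset setX E [set: bool] ->
    connect (bb T w') a b ->
    connect (bb T (flip F @: w')) (a.1, a.2 (+) s a.1) (b.1, b.2 (+) s b.1).
  move/subsetP=> w'E.
  apply: (@bb_homo T w' _ _ (fun c => (c.1, c.2 (+) s c.1))).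
    move=> z t k zt /=; have:= w'E _ zt; rewrite !inE andbT => eE.
    set f := [set z; t] \in F.
    have toF r : r \in [set z; t] ->
        connect (bb T (flip F @: w')) (r, k (+) s r) (r, k (+) f).
      by move=> /(sF _ _ eE)/orP[/eqP->|rT] //; apply: bb_post.
    apply: connect_trans (toF z _) _; first by rewrite !inE eqxx.
    rewrite bb_connect_sym; apply: connect_trans (toF t _) _.
      by rewrite !inE eqxx orbT.
    by rewrite bb_connect_sym; apply: bb_edge; rewrite mem_flip addbK.
  by move=> z k l zT /=; apply: bb_post.
move=> wE; apply/idP/idP => [|/impl->//].
move/(impl _ _ _ (flip_sub F wE)) => /=.
by rewrite flip_imsetK !addbK.
Qed.

Variable R : realType.
Implicit Type p : {set U} -> R.

Definition ebexp E p (G : {set {set U} * bool} -> R) : R :=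
  bexp (setX E [set: bool]) (fun f => p f.1) G.

Definition gap T v u w : R :=
  (connect (bb T w) (v, false) (u, false))%:R -
  (connect (bb T w) (v, false) (u, true))%:R.

(** The inequality for an edge set alone. [T] ranges over all vertex sets, because gluing may add
    the cut vertex to the posts. *)
Definition good E : Prop := forall T p v u,
  (forall e, e \in E -> 0 <= p e <= 1) -> 0 <= ebexp E p (gap T v u).

Lemma ebexp_ge0 E p G : (forall e, e \in E -> 0 <= p e <= 1) ->
  (forall w, w \subset setX E [set: bool] -> 0 <= G w) -> 0 <= ebexp E p G.
Proof.
by move=> p01; apply: bexp_ge0 => -[e i]; rewrite !inE andbT; apply: p01.
Qed.

Lemma eq_ebexp E p G G' :
  (forall w, w \subset setX E [set: bool] -> G w = G' w) ->
  ebexp E p G = ebexp E p G'.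
Proof. exact: eq_bexp. Qed.

Lemma ebexpU E F p G : [disjoint E & F] ->
  ebexp (E :|: F) p G =
    ebexp E p (fun w => ebexp F p (fun w' => G (w :|: w'))).
Proof.
move=> dEF; rewrite /ebexp -bexpU.
  by congr bexp; apply/setP=> -[e i]; rewrite !inE !andbT.
rewrite disjoints_subset; apply/subsetP => -[e i]; rewrite !inE !andbT.
by move=> /(disjointFr dEF)->.
Qed.

(** Both copies of an edge have the same probability, so the exchange permutes outcomes of equal
    weight. *)
Lemma ebexp_flip F E p G : ebexp E p G = ebexp E p (fun w => G (flip F @: w)).
Proof.
rewrite /ebexp; have DE : flip F @: setX E [set: bool] = setX E [set: bool].
  by apply/setP=> -[e i]; rewrite mem_flip !inE.
rewrite -[in LHS]DE bexp_imset; last exact: inv_inj (flipK F).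
by apply: eq_bexp => // f _; apply: eqF.
Qed.

Lemma ebexp_flip_opp F E p G :
    (forall w, w \subset setX E [set: bool] -> G (flip F @: w) = - G w) ->
  ebexp E p G = 0.
Proof.
move=> GN; have /eqP : ebexp E p G = - ebexp E p G.
  rewrite [LHS](ebexp_flip F) -mulN1r -bexpZ.
  by apply: eq_ebexp => w /GN->; rewrite mulN1r.
by rewrite -addr_eq0 -mulr2n mulrn_eq0 => /eqP.
Qed.

(** The case where [T] separates [v] from [u]: [s] marks the side of [u] and [F] its edges. The
    exchange fixes the copies of [v] and swaps those of [u], so the gap changes sign. *)
Lemma ebexp_gap0 E F T p v u (s : U -> bool) :
    (forall e z, e \in E -> z \in e -> (s z == (e \in F)) || (z \in T)) ->
    s v = false -> s u = true ->
  ebexp E p (gap T v u) = 0.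
Proof.
move=> sF sv su; apply: (@ebexp_flip_opp F) => w wE.
have C i := flip_connect v u false i sF wE; rewrite sv su addbF in C.
by rewrite /gap -(C true) -(C false) opprB.
Qed.
End Bunkbed.

(** * Gluing at a cut vertex *)

Section Gluing.
Variables (U : finType) (c : U) (V1 V2 : {set U}).
Hypothesis V12 : V1 :&: V2 = [set c].
Implicit Types (T : {set U}) (w : {set {set U} * bool}) (x y v u : U).

Let meet x : x \in V1 -> x \in V2 -> x = c.
Proof. by move=> x1 x2; apply/set1P; rewrite -V12 inE x1. Qed.

Let c2 : c \in V2.
Proof. by have: c \in V1 :&: V2; [rewrite V12 set11 | case/setIP]. Qed.

Let edge_in (V : {set U}) w x y i :
    (forall f, f \in w -> f.1 \subset V) -> ([set x; y], i) \in w ->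
  x \in V /\ y \in V.
Proof. by move=> wV /wV; rewrite subUset !sub1set => /andP. Qed.

(** An excursion into the first side starts and ends at copies of [c], so it can be replaced by a
    post at [c]. *)
Lemma glue_connect T w1 w2 x y i j :
    (forall f, f \in w1 -> f.1 \subset V1) ->
    (forall f, f \in w2 -> f.1 \subset V2) -> x \in V2 -> y \in V2 ->
  connect (bb T (w1 :|: w2)) (x, i) (y, j) =
    connect (bb (if connect (bb T w1) (c, false) (c, true) then c |: T else T)
                w2) (x, i) (y, j).
Proof.
move=> w1V w2V xV yV; set T' := if _ then _ else _.
have sTT' z : z \in T -> z \in T'.
  by rewrite /T'; case: ifP => // _ zT; rewrite setU1r.
have c_post k l : connect (bb T w1) (c, k) (c, l) ->
    connect (bb T' w2) (c, k) (c, l).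
  have [->|klN ckl] := eqVneq k l; first by rewrite connect0.
  apply: bb_post; rewrite /T'; case: ifP => [_|/negP[]]; first exact: setU11.
  by case: k l klN ckl => [] [] //= _; rewrite bb_connect_sym.
apply/idP/idP.
  (* Invariant along a walk: a vertex of [V2] is reached within the second side; any other vertex is
     reached within the first side from a copy of [c] that was itself reached. *)
  pose P a := if a.1 \in V2 then connect (bb T' w2) (x, i) a : Prop else
    exists2 k, connect (bb T' w2) (x, i) (c, k) & connect (bb T w1) (c, k) a.
  suff: connect (bb T (w1 :|: w2)) (x, i) (y, j) -> P (y, j).
    by rewrite /P /= yV.
  apply: bb_ind => [|z t k|z k l]; first by rewrite /P /= xV connect0.
    rewrite /P /= => Pz; rewrite inE => /orP[zt|zt]; last first.
      have [z2 t2] := edge_in w2V zt; rewrite z2 in Pz; rewrite t2.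
      exact: connect_trans Pz (bb_edge T' zt).
    have [z1 t1] := edge_in w1V zt.
    have {Pz} [k' xck' ck'z] : exists2 k', connect (bb T' w2) (x, i) (c, k') &
        connect (bb T w1) (c, k') (z, k).
      by case: ifP Pz => // z2 xz; exists k; rewrite -?(meet z1 z2) ?connect0.
    have ck't := connect_trans ck'z (bb_edge T zt).
    case: ifP => [t2|_]; last by exists k'.
    rewrite (meet t1 t2) in ck't *; exact: connect_trans xck' (c_post _ _ ck't).
  rewrite /P /=; case: ifP => _ => [xz zT|[k' xck' ck'z] zT].
    exact: connect_trans xz (bb_post _ _ _ (sTT' _ zT)).
  by exists k' => //; apply: connect_trans ck'z (bb_post _ _ _ zT).
apply: (@bb_homo _ _ _ _ _ id) => [z t k zt|z k l].
  by apply: bb_edge; rewrite inE zt orbT.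
rewrite /T'; case: ifP => [c01|_ zT]; last exact: bb_post.
case/setU1P => [->|]; last exact: bb_post.
have tot : connect (bb T (w1 :|: w2)) (c, false) (c, true).
  move: c01; apply: (@bb_homo _ _ _ _ _ id) => [z' t' k' zt'|z' k' l'].
    by apply: bb_edge; rewrite inE zt'.
  exact: bb_post.
by case: k l => [] []; rewrite ?connect0 // bb_connect_sym.
Qed.

(** A walk from [V1] to [V2] first stays within the first side and must visit a copy of [c] before
    using any edge of the second. *)
Lemma glue_through T w1 w2 x y i j :
    (forall f, f \in w1 -> f.1 \subset V1) ->
    (forall f, f \in w2 -> f.1 \subset V2) -> x \in V1 -> y \in V2 ->
  connect (bb T (w1 :|: w2)) (x, i) (y, j) =
    [exists k, connect (bb T w1) (x, i) (c, k) &&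
               connect (bb T (w1 :|: w2)) (c, k) (y, j)].
Proof.
move=> w1V w2V xV yV; apply/idP/existsP => [|[k /andP[xck]]]; last first.
  apply: connect_trans; move: xck.
  apply: (@bb_homo _ _ _ _ _ id) => [z' t' k' zt'|z' k' l'].
    by apply: bb_edge; rewrite inE zt'.
  exact: bb_post.
pose P (a : U * bool) := (a.1 \in V1 /\ connect (bb T w1) (x, i) a) \/
  exists k, connect (bb T w1) (x, i) (c, k) &&
            connect (bb T (w1 :|: w2)) (c, k) a.
suff: connect (bb T (w1 :|: w2)) (x, i) (y, j) -> P (y, j).
  move=> sP /sP[[/= y1 xy]|//]; exists j.
  by rewrite -(meet y1 yV) xy connect0.
apply: bb_ind => [|z t k|z k l]; first by left; rewrite connect0.
  move=> [[z1 xz] zt|[k' /andP[xck' ck'z]] zt]; last first.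
    by right; exists k'; rewrite xck'; apply: connect_trans ck'z (bb_edge T zt).
  move: (zt); rewrite inE => /orP[zt1|zt2].
    left; split; first by case: (edge_in w1V zt1).
    exact: connect_trans xz (bb_edge T zt1).
  have zc := meet z1 (edge_in w2V zt2).1; right; exists k.
  by rewrite -zc xz; apply: bb_edge.
move=> [[z1 xz] zT|[k' /andP[xck' ck'z]] zT].
  by left; split=> //; apply: connect_trans xz (bb_post _ _ _ zT).
by right; exists k'; rewrite xck'; apply: connect_trans ck'z (bb_post _ _ _ zT).
Qed.

Variables (R : realType) (E1 E2 : {set {set U}}).
Hypothesis E1V : forall e, e \in E1 -> e \subset V1.
Hypothesis E2V : forall e, e \in E2 -> e \subset V2.
Hypothesis E12 : [disjoint E1 & E2].

Let wV (E : {set {set U}}) (V : {set U}) w :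
    (forall e, e \in E -> e \subset V) -> w \subset setX E [set: bool] ->
  forall f : {set U} * bool, f \in w -> f.1 \subset V.
Proof. by move=> EV /subsetP wE f /wE; rewrite !inE andbT => /EV. Qed.

(** Given the outcome on the first side, the conditional expectation is that of the second side
    alone, possibly with [c] as an extra post. *)
Lemma glue_same_side T (p : {set U} -> R) v u : good R E2 ->
    (forall e, e \in E1 :|: E2 -> 0 <= p e <= 1) -> v \in V2 -> u \in V2 ->
  0 <= ebexp (E1 :|: E2) p (gap R T v u).
Proof.
move=> g2 p01 v2 u2; rewrite ebexpU //; apply: ebexp_ge0 => [e e1|w1 w1E].
  by rewrite p01 // inE e1.
have p2 e : e \in E2 -> 0 <= p e <= 1 by move=> e2; rewrite p01 // inE e2 orbT.
set T' := if connect (bb T w1) (c, false) (c, true) then c |: T else T.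
apply: le_trans (g2 T' p v u p2) _; rewrite le_eqVlt; apply/orP; left.
apply/eqP/eq_ebexp => w2 w2E; rewrite /gap.
have [w1V w2V] := (wV E1V w1E, wV E2V w2E).
by rewrite !(glue_connect _ _ _ w1V w2V).
Qed.

(* Conditionally on the first side, the two levels of the cut vertex are either
   connected, and then the gap averages to 0 by symmetry, or at most one of
   them is reached from [(v, false)], and swapping levels on the second side
   turns a start at [(c, true)] into a start at [(c, false)]. *)
Lemma glue_cross T (p : {set U} -> R) v u : v \in V1 -> u \in V2 ->
  ebexp (E1 :|: E2) p (gap R T v u) =
    ebexp E1 p (gap R T v c) * ebexp E2 p (gap R T c u).
Proof.
move=> v1 u2; rewrite ebexpU // mulrC -bexpZ; apply: eq_ebexp => w1 w1E.
rewrite mulrC {2}/gap.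
set a0 := connect _ _ _; set a1 := connect _ _ _.
have tot w2 : w2 \subset setX E2 [set: bool] ->
    forall j, connect (bb T (w1 :|: w2)) (v, false) (u, j) =
      a0 && connect (bb T (w1 :|: w2)) (c, false) (u, j) ||
      a1 && connect (bb T (w1 :|: w2)) (c, true) (u, j).
  move=> w2E j; rewrite (glue_through _ _ _ (wV E1V w1E) (wV E2V w2E)) //.
  apply/existsP/orP => [[[]]|[]].
  - by right.
  - by left.
  - by exists false.
  - by exists true.
have tot2 w2 : w2 \subset setX E2 [set: bool] -> forall k j,
    connect (bb T (w1 :|: w2)) (c, k) (u, j) =
      connect (bb (if connect (bb T w1) (c, false) (c, true) then c |: T else T)
                  w2) (c, k) (u, j).
  by move=> w2E k j; rewrite (glue_connect _ _ _ (wV E1V w1E) (wV E2V w2E)).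
have [c01|c01N] := boolP (connect (bb T w1) (c, false) (c, true)).
  have a01 : a0 = a1.
    apply/idP/idP => h; apply: connect_trans h _ => //.
    by rewrite bb_connect_sym.
  rewrite a01 subrr mul0r -(mulr0 (a1%:R : R)).
  suff <- : ebexp E2 p (gap R (c |: T) c u) = 0.
    rewrite -bexpZ; apply: eq_ebexp => w2 w2E; rewrite /gap !tot // a01.
    rewrite !tot2 // c01.
    have cT : c \in c |: T by rewrite setU11.
    have C j : connect (bb (c |: T) w2) (c, true) (u, j) =
        connect (bb (c |: T) w2) (c, false) (u, j).
      exact: (same_connect (bb_connect_sym _ _) (bb_post _ _ _ cT)).
    by rewrite !C; case: (a1); rewrite /= ?orbb ?mul0r ?subrr ?mul1r.
  (* If [u] is [c], both copies are reached and the gap is pointwise 0. Otherwise the post at [c]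
     separates [c] from [u]. *)
  have [->|uc] := eqVneq u c.
    apply: (@ebexp_flip_opp _ _ set0) => w2 _; rewrite /gap !connect0.
    by rewrite !bb_post ?setU11 // subrr oppr0.
  apply: (@ebexp_gap0 _ _ _ [set: {set U}] _ _ _ _ (fun z => z != c)) => //=.
    by move=> e z _ _; rewrite !inE; case: (z =P c).
  by rewrite eqxx.
have flipN : ebexp E2 p (fun w => (connect (bb T w) (c, true) (u, false))%:R -
    (connect (bb T w) (c, true) (u, true))%:R) = - ebexp E2 p (gap R T c u).
  rewrite (ebexp_flip [set: {set U}]) -mulN1r -bexpZ.
  apply: eq_ebexp => w2 w2E; rewrite mulN1r opprB.
  have C j : connect (bb T (flip [set: {set U}] @: w2)) (c, true) (u, ~~ j) =
      connect (bb T w2) (c, false) (u, j).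
    rewrite -(@flip_connect U E2 [set: {set U}] T w2 xpredT) ?addbT //.
    by move=> e z _ _; rewrite inE.
  by rewrite -(C true) -(C false).
rewrite mulrBl -mulrN -flipN -!bexpZ -bexpD; apply: eq_ebexp => w2 w2E.
rewrite /gap !tot // !tot2 // (negPf c01N).
have : ~~ (a0 && a1).
  apply: contra c01N => /andP[h0 h1]; apply: connect_trans h1.
  by rewrite bb_connect_sym.
by case: (a0) (a1) => [] [] //= _;
  rewrite ?orbF ?mul1r ?mul0r ?addr0 ?add0r ?oppr0.
Qed.
End Gluing.

Lemma good_glue (R : realType) (U : finType) (c : U) (V1 V2 : {set U})
    (E1 E2 : {set {set U}}) :
    V1 :&: V2 = [set c] -> V1 :|: V2 = [set: U] ->
    (forall e, e \in E1 -> e \subset V1) ->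
    (forall e, e \in E2 -> e \subset V2) ->
    [disjoint E1 & E2] -> good R E1 -> good R E2 ->
  good R (E1 :|: E2).
Proof.
move=> V12 V12T E1V E2V E12 g1 g2 T p v u p01.
have V21 : V2 :&: V1 = [set c] by rewrite setIC.
have E21 : [disjoint E2 & E1] by rewrite disjoint_sym.
have p1 e : e \in E1 -> 0 <= p e <= 1 by move=> eE; rewrite p01 // inE eE.
have p2 e : e \in E2 -> 0 <= p e <= 1 by move=> eE; rewrite p01 // inE eE orbT.
have cases x : (x \in V1) || (x \in V2) by rewrite -in_setU V12T inE.
case/orP: (cases v) => vV; case/orP: (cases u) => uV.
- rewrite setUC (glue_same_side V21 E2V E1V) // => e; rewrite setUC.
  exact: p01.
- by rewrite (glue_cross V12 E1V E2V) // mulr_ge0 ?g1 ?g2.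
- by rewrite setUC (glue_cross V21 E2V E1V) // mulr_ge0 ?g1 ?g2.
- by rewrite (glue_same_side V12 E1V E2V).
Qed.

(** * Cycles *)

(** For [v = u] the gap is pointwise nonnegative. A vertex on no edge is isolated apart from its
    post, so exchanging levels on one of [v], [u] and not on the other gives expectation 0. *)
Lemma good_cover (R : realType) (U : finType) (E : {set {set U}}) :
    (forall T p v u, (forall e, e \in E -> 0 <= p e <= 1) ->
       v \in cover E -> u \in cover E -> v != u ->
       0 <= ebexp E p (gap R T v u)) ->
  good R E.
Proof.
move=> gE T p v u p01; have [->|vu] := eqVneq v u.
  by apply: ebexp_ge0 => // w _; rewrite /gap connect0 subr_ge0 lern1 leq_b1.
have coverP e z : e \in E -> z \in e -> z \in cover E.
  by move=> eE ze; apply/bigcupP; exists e.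
have [vE|vE] := boolP (v \in cover E); last first.
  suff -> : ebexp E p (gap R T v u) = 0 by [].
  apply: (@ebexp_gap0 _ _ _ [set: {set U}] _ _ _ _ (predC1 v)) => [e z eE ze||].
  - have zv : z != v by apply: contraNneq vE => <-; apply: coverP ze.
    by rewrite !inE zv.
  - by rewrite /= eqxx.
  - by rewrite /= eq_sym.
have [uE|uE] := boolP (u \in cover E); first exact: gE.
suff -> : ebexp E p (gap R T v u) = 0 by [].
apply: (@ebexp_gap0 _ _ _ set0 _ _ _ _ (pred1 u)) => [e z eE ze||].
- have zu : z != u by apply: contraNneq uE => <-; apply: coverP ze.
  by rewrite !inE (negPf zu).
- exact: negbTE.
- by rewrite /= eqxx.
Qed.

Lemma set2_eq (V : finType) (x y a b : V) :
  [set x; y] = [set a; b] -> (x = a /\ y = b) \/ (x = b /\ y = a).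
Proof.
move=> eq; have ab z : (z \in [set a; b]) = (z \in [set x; y]) by rewrite eq.
have /set2P xab : x \in [set a; b] by rewrite ab set21.
have /set2P yab : y \in [set a; b] by rewrite ab set22.
have /set2P axy : a \in [set x; y] by rewrite -ab set21.
have /set2P bxy : b \in [set x; y] by rewrite -ab set22.
case: xab yab axy bxy => -> [] -> [] ? [] ?; auto.
Qed.

(** The letters stand for the connections between levels 00, 01, 11 and 10 of two vertices. If [a]
    holds, either [b] holds too and both differences vanish, or the first is 1 and the second at
    least -1; the case [c] is symmetric. *)
Lemma sum_gap_ge0 (R : numDomainType) (a b c d : bool) :
    (a -> b -> d = c) -> (c -> d -> b = a) -> a || c ->
  0 <= (a%:R - b%:R) + (c%:R - d%:R) :> R.
Proof.
case: a b c d => [] [] [] [] // T0 T1 _;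
  rewrite addrACA -opprD subr_ge0 -!natrD ler_nat //=.
all: by [have := T0 isT isT | have := T1 isT isT].
Qed.

Section Cycle.
Variables (R : realType) (U : finType) (n : nat) (h : nat -> U).
Hypotheses (n_ge3 : (3 <= n)%N) (hn : h n = h 0%N).
Hypothesis h_inj : forall k l, (k < n)%N -> (l < n)%N -> h k = h l -> k = l.

(** As [h n = h 0], the two arcs between [h 0] and [h m] are the index intervals from 0 to [m] and
    from [m] to [n]. *)
Let edge k := [set h k; h k.+1].
Let E := [set edge k | k : 'I_n].

Let hE k l : (k <= n)%N -> (l <= n)%N -> h k = h l ->
  [\/ k = l, k = 0%N /\ l = n | k = n /\ l = 0%N].
Proof.
have n0 : (0 < n)%N by apply: leq_trans n_ge3.
rewrite leq_eqVlt [(l <= n)%N]leq_eqVlt => /orP[/eqP->|kn] /orP[/eqP->|ln].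
- by constructor 1.
- by rewrite hn => /(h_inj n0 ln)<-; constructor 3.
- by rewrite hn => /(h_inj kn n0)->; constructor 2.
- by move/(h_inj kn ln)->; constructor 1.
Qed.

(** Matching the endpoints crosswise would give [k = l + 1] and [l = k + 1] modulo [n], impossible
    for [n >= 3]. *)
Let edge_inj k l : (k < n)%N -> (l < n)%N -> edge k = edge l -> k = l.
Proof.
move=> kn ln /set2_eq[[/h_inj->//]|[kl lk]].
have := hE (ltnW kn) ln kl; have := hE kn (ltnW ln) lk.
by move=> [] ? [] ?; lia.
Qed.

(** Vertices off the cycle get the default value [n], while [h n] gets 0. *)
Let pos x := index x (mkseq h n).

Let pos_h k : (k < n)%N -> pos (h k) = k.
Proof.
move=> kn; rewrite /pos -(nth_mkseq (h 0%N) h kn) index_uniq ?size_mkseq //.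
apply/(uniqP (h 0%N)) => i j; rewrite !inE size_mkseq => ik jk.
by rewrite !nth_mkseq //; apply: h_inj.
Qed.

Let h_pos x : (pos x < n)%N -> h (pos x) = x.
Proof.
move=> xn; have x_h : x \in mkseq h n by rewrite -index_mem size_mkseq.
by rewrite -[RHS](nth_index (h 0%N) x_h) nth_mkseq.
Qed.

Let arc s t := [set edge k | k : 'I_n & (s <= k < t)%N].

Let mem_arc s t k : (k < n)%N -> (edge k \in arc s t) = (s <= k < t)%N.
Proof.
move=> kn; apply/imsetP/idP => [[l]|skt]; last first.
  by exists (Ordinal kn); rewrite ?inE.
by rewrite inE => slt /(edge_inj kn (ltn_ord l))->.
Qed.

Lemma cycle_gap_posts (T : {set U}) (p : {set U} -> R) (m s t : nat) :
    (0 < m < n)%N -> (s <= m <= t)%N -> (t <= n)%N -> h s \in T -> h t \in T ->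
  ebexp E p (gap R T (h 0%N) (h m)) = 0.
Proof.
move=> m0n smt tn sT tT.
(* The first disjunct matters when [m] is [s] or [t], so that [h m] is itself one of the two
   posts. *)
pose sg x := (x == h m) || (s < pos x < t)%N.
have sgE k : (k <= n)%N -> h k \notin T -> sg (h k) = (s < k < t)%N.
  move=> kn kT; rewrite /sg; have [km|km] := eqVneq (h k) (h m).
    have -> : k = m by have [] := hE kn _ km; lia.
    have sm : s != m by apply: contraNneq kT => eq; rewrite km -eq.
    have tm : t != m by apply: contraNneq kT => eq; rewrite km -eq.
    lia.
  have [kn'|kn'] := ltnP k n; first by rewrite pos_h.
  have -> : k = n by lia.
  by rewrite hn pos_h; lia.
apply: (@ebexp_gap0 _ _ _ (arc s t) _ _ _ _ sg).
- move=> _ z /imsetP[k _ ->]; rewrite mem_arc // orbC => zk.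
  have [//|zT] := boolP (z \in T); have kn := ltn_ord k.
  case/set2P: zk => Dz; rewrite Dz in zT *; rewrite sgE //; try lia.
    have ks : s != k by apply: contraNneq zT => <-.
    by apply/eqP; lia.
  have ks : t != k.+1 by apply: contraNneq zT => <-.
  by apply/eqP; lia.
- rewrite /sg pos_h; last by lia.
  by case: eqP => [/hE|_]; [case; lia|].
- by rewrite /sg eqxx.
Qed.

Section PostFreeArc.
Variables (T : {set U}) (m : nat).
Hypothesis m0n : (0 < m < n)%N.
Hypothesis mnT : forall k, (m <= k <= n)%N -> h k \notin T.
Implicit Type w : {set {set U} * bool}.

(** The stretch from [h k] to [h n = h 0] of the post-free arc is open on level [i]; vacuous at
    [k = n]. *)
Let open w k i := [forall l : 'I_n, (k <= l)%N ==> ((edge l, i) \in w)].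

Let openS w k i : (k < n)%N -> (edge k, i) \in w -> open w k i = open w k.+1 i.
Proof.
move=> kn kw; apply/forall_inP/forall_inP => ow l kl; first by apply: ow; lia.
have [<-//|lk] := eqVneq k l; by apply: ow; lia.
Qed.

Let blocked w := ~~ open w m false && ~~ open w m true.

(** A walk inside the post-free arc keeps its level and, the arc being blocked, leaves by the end
    through which it entered. Such excursions can be cut out, and then only the post [h s] has to
    reconcile flipped and unflipped edges. *)
Lemma cycle_flip_connect s w j : (0 < s < m)%N -> h s \in T ->
    w \subset setX E [set: bool] -> blocked w ->
  connect (bb T w) (h 0%N, false) (h m, j) ->
  connect (bb T (flip (arc s m) @: w)) (h 0%N, false) (h m, ~~ j).
Proof.
move=> s0m sT /subsetP wE /andP[bl0 bl1].
have bl i : open w m i = false by case: i; apply: negbTE.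
(* Interior vertices of the post-free arc, whose edges are not flipped, are
   collapsed to an endpoint: to [h 0] if they are joined to it on their level. *)
pose phi (a : U * bool) : U * bool :=
  if (pos a.1 <= s)%N || (n <= pos a.1)%N then a
  else if (pos a.1 <= m)%N then (a.1, ~~ a.2)
  else if open w (pos a.1) a.2 then (h 0%N, a.2) else (h m, ~~ a.2).
have phi1 k i : (k <= s)%N -> phi (h k, i) = (h k, i).
  by move=> ks; rewrite /phi /= pos_h ?ks //; lia.
have phi2 k i : (s < k <= m)%N -> phi (h k, i) = (h k, ~~ i).
  move=> skm; rewrite /phi /= pos_h; last by lia.
  by do 2?case: ifP => //; lia.
have phi3 k i : (m <= k <= n)%N ->
    phi (h k, i) = if open w k i then (h 0%N, i) else (h m, ~~ i).
  move=> mkn; have [->|km] := eqVneq k m; first by rewrite bl phi2 //; lia.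
  have [->|kn] := eqVneq k n.
    have -> : open w n i by apply/forall_inP => l; rewrite leqNgt ltn_ord.
    by rewrite hn phi1.
  rewrite /phi /= pos_h; last by lia.
  by do 2?case: ifP => //; lia.
have step k i : (k < n)%N -> (edge k, i) \in w ->
    connect (bb T (flip (arc s m) @: w)) (phi (h k, i)) (phi (h k.+1, i)).
  move=> kn kw; have [km|mk] := ltnP k m; last first.
    (* A present edge of the post-free arc does not change [open], so its two ends collapse to the
       same vertex. *)
    by rewrite !phi3 ?(openS kn kw) ?connect0 //; lia.
  have [ks|sk] := ltnP k s.
    rewrite !phi1; try lia.
    by apply: bb_edge; rewrite mem_flip mem_arc // leqNgt ks addbF.
  rewrite (phi2 k.+1); last by lia.
  (* At [k = s] the image changes level through the post; beyond it the image already lies on the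
     other level. *)
  apply: (@connect_trans _ _ (h k, ~~ i)).
    have [->|ks] := eqVneq k s; first by rewrite phi1 //; apply: bb_post.
    by rewrite phi2 ?connect0 //; lia.
  by apply: bb_edge; rewrite mem_flip mem_arc // sk km addbT negbK.
move/(@bb_homo _ _ _ _ (bb T (flip (arc s m) @: w)) phi).
rewrite phi1 // phi2; last by lia.
apply=> [x y i xyw|x i k xT].
  have := wE _ xyw; rewrite in_setX in_setT andbT /= => /imsetP[l _ eq].
  have lw : (edge l, i) \in w by rewrite -eq.
  case: (set2_eq eq) => -[-> ->]; last rewrite bb_connect_sym.
    exact: step.
  exact: step.
rewrite /phi /=; case: ifP => [_|/negbT]; first exact: bb_post.
rewrite negb_or => /andP[_ xn]; case: ifP => [_|xm]; first exact: bb_post.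
have /negP[] : h (pos x) \notin T by apply: mnT; lia.
by rewrite h_pos //; lia.
Qed.

Lemma cycle_gap_free_arc (p : {set U} -> R) :
  (forall e, e \in E -> 0 <= p e <= 1) ->
  0 <= ebexp E p (gap R T (h 0%N) (h m)).
Proof.
move=> p01.
have [/existsP[s /andP[s0m sT]]|noT] :=
    boolP [exists s : 'I_n, (0 < s < m)%N && (h s \in T)]; last first.
  have hT k : (k <= n)%N -> h k \notin T.
    move=> kn; have [km|mk] := ltnP k m; last by apply: mnT; lia.
    have [->|k0] := posnP k; first by rewrite -hn mnT //; lia.
    have kn' : (k < n)%N by lia.
    apply: contra noT => kT; apply/existsP; exists (Ordinal kn').
    by rewrite /= k0 km kT.
  apply: ebexp_ge0 => // w /subsetP wE; rewrite /gap.
  suff -> : connect (bb T w) (h 0%N, false) (h m, true) = false.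
    by rewrite subr0 ler0n.
  (* With no post on the cycle, a walk cannot leave level 0. *)
  apply/negP; pose P (a : U * bool) := a.2 = false /\ a.1 \notin T.
  move=> c; suff [] : P (h m, true) by [].
  apply: bb_ind c => [|x y i|x i j].
  - by split => //=; apply: hT.
  - move=> [/= -> xT] /wE; rewrite in_setX in_setT andbT /=.
    move=> /imsetP[l _ /set2_eq[]] [_ ->].
      by split => //=; apply: hT; apply: ltn_ord.
    by split => //=; apply: hT; apply: ltnW; apply: ltn_ord.
  - by move=> [_ /= /negP].
pose G w := gap R T (h 0%N) (h m) w.
have -> : ebexp E p G = ebexp E p (fun w => if blocked w then G w else 0) +
                        ebexp E p (fun w => if blocked w then 0 else G w).
  rewrite /ebexp -bexpD; apply: eq_bexp => // w _.
  by case: ifP; rewrite ?addr0 ?add0r.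
have arcN k : (m <= k)%N -> (k < n)%N -> (edge k \in arc s m) = false.
  by move=> mk kn; rewrite mem_arc //; lia.
have blF w : blocked (flip (arc s m) @: w) = blocked w.
  have oF i : open (flip (arc s m) @: w) m i = open w m i.
    apply: eq_forallb => k; have [mk|//] := leqP m k.
    by rewrite mem_flip arcN // addbF.
  by rewrite /blocked !oF.
rewrite (@ebexp_flip_opp _ _ (arc s m)) ?add0r; last first.
  move=> w wE; rewrite blF; case: ifP => [bl|]; last by rewrite oppr0.
  have C j : connect (bb T (flip (arc s m) @: w)) (h 0%N, false) (h m, ~~ j) =
      connect (bb T w) (h 0%N, false) (h m, j).
    apply/idP/idP; last exact: cycle_flip_connect.
    move/(cycle_flip_connect s0m sT (flip_sub _ wE)).
    by rewrite blF negbK flip_imsetK; apply.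
  by rewrite /G /gap -(C true) -(C false) opprB.
(* One of the two copies of [X] is rewritten by the global exchange, so that each gap is added to
   its mirror image. *)
set X := ebexp _ _ _; suff : 0 <= X + X by rewrite -mulr2n pmulrn_lge0.
rewrite {2}/X (ebexp_flip [set: {set U}]) /X /ebexp -bexpD.
apply: ebexp_ge0 => // w wE.
have oT i : open (flip [set: {set U}] @: w) m i = open w m (~~ i).
  by apply: eq_forallb => k; rewrite mem_flip inE addbT.
rewrite /blocked !oT andbC; case: ifP => [|/negbT]; first by rewrite addr0.
rewrite negb_and !negbK => op.
have C i j : connect (bb T (flip [set: {set U}] @: w)) (h 0%N, i) (h m, j) =
    connect (bb T w) (h 0%N, ~~ i) (h m, ~~ j).
  rewrite -(@flip_connect U E [set: {set U}] T w xpredT) ?addbT ?negbK //.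
  by move=> e z _ _; rewrite inE.
rewrite /G /gap !C /=.
have run i : open w m i -> connect (bb T w) (h 0%N, i) (h m, i).
  move=> /forall_inP ow; rewrite bb_connect_sym.
  (* Walk along the open arc from [h m] up to [h n], which is [h 0]. *)
  suff H k : (m + k <= n)%N -> connect (bb T w) (h m, i) (h (m + k)%N, i).
    by have := H (n - m)%N; rewrite subnKC ?hn; [apply|]; lia.
  elim: k => [|k IHk]; first by rewrite addn0 connect0.
  rewrite addnS => mkn; apply: connect_trans (IHk (ltnW mkn)) _.
  by apply: bb_edge; apply: (ow (Ordinal mkn)); apply: leq_addr.
have Tr a b c : connect (bb T w) a b -> connect (bb T w) a c ->
    forall d, connect (bb T w) d b = connect (bb T w) d c.
  move=> ab ac d; apply: same_connect_r; first exact: bb_connect_sym.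
  by apply: connect_trans ac; rewrite bb_connect_sym.
apply: sum_gap_ge0.
- by move=> h00 h01; apply: (Tr _ _ _ h00 h01).
- by move=> h11 h10; apply: (Tr _ _ _ h11 h10).
- by case/orP: op => /run->; rewrite ?orbT.
Qed.
End PostFreeArc.
End Cycle.

(** The cycle is enumerated from [v], so that [u = h m] with [0 < m < n]. Either both arcs contain a
    post, endpoints included, or one arc is free of posts and is made the second one. *)
Lemma good_cycle (R : realType) (U : finType) (n : nat) (g : 'I_n -> U) :
  (3 <= n)%N -> injective g -> good R [set [set g i; g (ordS i)] | i : 'I_n].
Proof.
move=> n3 g_inj; apply: good_cover => T p v u p01 vE uE vu.
have cov x : x \in cover [set [set g i; g (ordS i)] | i : 'I_n] ->
    exists i, x = g i.
  move=> /bigcupP[_ /imsetP[i _ ->] /set2P[]->]; by [exists i|exists (ordS i)].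
have [a Dv] := cov v vE; have [b Du] := cov u uE.
have it k : iter k (@ordS n) a = ((a + k) %% n)%N :> nat.
  elim: k => [|k IHk] /=; first by rewrite addn0 modn_small.
  by rewrite IHk -addn1 modnDml addn1 addnS.
pose h k := g (iter k (@ordS n) a).
have hn : h n = h 0%N.
  by congr g; apply: val_inj; rewrite /= it modnDr modn_small.
have h_inj k l : (k < n)%N -> (l < n)%N -> h k = h l -> k = l.
  move=> kn ln /g_inj/(congr1 val); rewrite /= !it => /eqP.
  by rewrite eqn_modDl !modn_small // => /eqP.
have onto i : exists2 k : 'I_n, i = iter k (@ordS n) a & h k = g i.
  (* The index of [g i] is [i - a] modulo [n]. *)
  have kn : ((i + (n - a)) %% n < n)%N by rewrite ltn_mod; lia.
  suff eq : i = iter (Ordinal kn) (@ordS n) a.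
    by exists (Ordinal kn); rewrite // /h -eq.
  apply: val_inj; rewrite /= it modnDmr addnCA subnKC ?modnDr ?modn_small //.
  exact: ltnW.
have ED : [set [set g i; g (ordS i)] | i : 'I_n] =
          [set [set h k; h k.+1] | k : 'I_n].
  apply/setP=> e; apply/imsetP/imsetP => -[i _ ->].
    by have [k eq hk] := onto i; exists k; rewrite // /h /= -eq.
  by exists (iter i (@ordS n) a).
rewrite ED in p01 *; have [m _ hm] := onto b.
rewrite Dv -/(h 0%N).
have Dm : u = h m by rewrite hm.
have m0 : (0 < m)%N.
  by rewrite lt0n; apply: contraNneq vu => m0; rewrite Dv Dm m0 eqxx.
have mn := ltn_ord m; rewrite Dm.
have [/existsP[s /andP[sm sT]]|noS] :=
    boolP [exists s : 'I_n.+1, (s <= m)%N && (h s \in T)]; last first.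
  (* The first arc is free of posts: reversing the orientation turns it into the second. *)
  pose h' k := h (n - k)%N.
  have -> : h 0%N = h' 0%N by rewrite /h' subn0.
  have -> : h m = h' (n - m)%N by rewrite /h' subKn // ltnW.
  have ED' : [set [set h k; h k.+1] | k : 'I_n] =
             [set [set h' k; h' k.+1] | k : 'I_n].
    apply/setP=> e; apply/imsetP/imsetP => -[i _ ->];
      exists (rev_ord i) => //=; rewrite /h' setUC.
      by rewrite subKn //; congr [set h _; h _]; have := ltn_ord i; lia.
    by congr [set h _; h _]; have := ltn_ord i; lia.
  rewrite ED' in p01 *; apply: cycle_gap_free_arc => //.
  - by rewrite /h' subn0 subnn.
  - move=> k l kn ln; rewrite /h'.
    have [->|k0] := posnP k; have [->|l0] := posnP l => //;
      rewrite ?subn0 ?hn => /h_inj; lia.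
  - by lia.
  - move=> k mkn; apply: contra noS => kT.
    have kn : (n - k < n.+1)%N by lia.
    by apply/existsP; exists (Ordinal kn); rewrite /= kT andbT; lia.
have [/existsP[t /andP[mt tT]]|noT] :=
    boolP [exists t : 'I_n.+1, (m <= t)%N && (h t \in T)].
  have tn : (t <= n)%N by rewrite -ltnS.
  have m0n : (0 < m < n)%N by rewrite m0.
  have smt : (s <= m <= t)%N by rewrite sm.
  by rewrite (cycle_gap_posts n3 hn h_inj p m0n smt tn sT tT).
apply: cycle_gap_free_arc => //; first by rewrite m0.
move=> k /andP[mk kn]; apply: contra noT => kT.
by apply/existsP; exists (Ordinal (kn : (k < n.+1)%N)); rewrite /= mk.
Qed.

(** * At most four vertices *)

Definition merge_labels (L : seq nat) (a b : nat) : seq nat :=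
  let la := nth 0%N L a in let lb := nth 0%N L b in
  [seq if l == la then lb else l | l <- L].

(* Each element of [S] labels the components of one outcome, with vertices 0, 1
   as the endpoints [v], [w]. The recursive calls treat the edge as absent on both
   levels, present on both, and present on exactly one. *)
Fixpoint gap_check (l : seq (nat * nat)) (S : seq (seq nat)) : bool :=
  if l is (i, j) :: l' then
    let m0 L := merge_labels L (i.*2 + false) (j.*2 + false) in
    let m1 L := merge_labels L (i.*2 + true) (j.*2 + true) in
    [&& gap_check l' S, gap_check l' [seq m1 (m0 L) | L <- S] &
        gap_check l' ([seq m0 L | L <- S] ++ [seq m1 L | L <- S])]
  else (count (fun L => nth 0%N L 0 == nth 0%N L 3) S <=
        count (fun L => nth 0%N L 0 == nth 0%N L 2) S)%N.

(** The components without horizontal edges. Position [2 * i + b] is the copy of vertex [i] on level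
    [b], so positions 0, 2, 3 in [gap_check] are [v_0], [w_0], [w_1]. *)
Definition post_labels (ts : seq bool) : seq nat :=
  mkseq (fun k => if nth false ts k./2 then k./2.*2 else k) (size ts).*2.

Definition index_pairs (k : nat) : seq (nat * nat) :=
  [seq (i, j) | j <- iota 0 k, i <- iota 0 j].

(** The complete graphs on 2, 3 and 4 vertices, with 4, 8 and 16 patterns of posts. Six edges with
    three states each give [3 ^ 6] final comparisons per pattern. *)
Lemma gap_check_small (ts : seq bool) : (2 <= size ts <= 4)%N ->
  gap_check (index_pairs (size ts)) [:: post_labels ts].
Proof.
case: ts => [|a [|b [|c [|d [|? ?]]]]] // _.
- by case: a b => [] []; vm_compute.
- by case: a b c => [] [] []; vm_compute.
- by case: a b c d => [] [] [] []; vm_compute.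
Qed.

Lemma mem_index_pairs k i j : ((i, j) \in index_pairs k) = (i < j < k)%N.
Proof.
apply/allpairsPdep/idP => [[j' [i' [+ + [-> ->]]]]|/andP[ij jk]].
  by rewrite !mem_iota /= !add0n => -> ->.
by exists j, i; split=> //; rewrite mem_iota.
Qed.

Lemma index_pairs_uniq k : uniq (index_pairs k).
Proof.
apply: allpairs_uniq_dep => [|j _|]; rewrite ?iota_uniq //.
by move=> [j i] [j' i'] _ _ /= [-> ->].
Qed.

Section FewVertices.
Variables (R : realType) (U : finType) (v0 : U) (vs : seq U).
Hypothesis vs_uniq : uniq vs.
Implicit Types (T : {set U}) (w : {set {set U} * bool}) (L : seq nat).
Implicit Types (p : {set U} -> R).

Let edge (e : nat * nat) := [set nth v0 vs e.1; nth v0 vs e.2].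

(* Label [i.*2 + b] is that of the copy of the [i]-th vertex on level [b]. *)
Definition labels_components T w L : Prop :=
  size L = (size vs).*2 /\
  forall i j a b, (i < size vs)%N -> (j < size vs)%N ->
    connect (bb T w) (nth v0 vs i, a) (nth v0 vs j, b) =
      (nth 0%N L (i.*2 + a) == nth 0%N L (j.*2 + b)).

Lemma post_labels_components T :
  labels_components T set0 (post_labels [seq x \in T | x <- vs]).
Proof.
split=> [|i j a b ik jk]; first by rewrite size_mkseq size_map.
have idx (l : nat) (c : bool) : (l < size vs)%N -> (l.*2 + c < (size vs).*2)%N.
  by case: c; lia.
have half (l : nat) (c : bool) : (l.*2 + c)./2 = l.
  by rewrite addnC half_bit_double.
rewrite !nth_mkseq ?size_map ?idx // !half !(nth_map v0) //.
apply/idP/eqP => [|eq].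
  pose P (x : U * bool) :=
    x.1 = nth v0 vs i /\ (x.2 = a \/ nth v0 vs i \in T).
  move=> c; have : P (nth v0 vs j, b).
    apply: bb_ind c => [|x y l _|x l l' [/= -> _] xT].
      by split=> //; left.
      by rewrite inE.
    by split=> //; right.
  move=> [/= /eqP]; rewrite nth_uniq // => /eqP-> [->//|->//].
have ij : i = j.
  by move: eq; case: ifP; case: ifP => _ _; case: a b => [] []; lia.
rewrite -ij in eq *; case: ifP eq => [iT _|_]; first exact: bb_post.
by move/addnI; case: a b => [] [] //=; rewrite connect0.
Qed.

(** A path needs the new edge at most once, in one direction or the other. *)
Lemma connect_bb_setU1 T w x y i a b :
  let X := (x, i) in let Y := (y, i) in
  connect (bb T (([set x; y], i) |: w)) a b =
    [|| connect (bb T w) a b, connect (bb T w) a X && connect (bb T w) Y b |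
        connect (bb T w) a Y && connect (bb T w) X b].
Proof.
move=> X Y; apply/idP/idP => [|c].
  pose P c := is_true [|| connect (bb T w) a c,
    connect (bb T w) a X && connect (bb T w) Y c |
    connect (bb T w) a Y && connect (bb T w) X c].
  have tr c d : connect (bb T w) c d -> P c -> P d.
    move=> cd /or3P[h|/andP[h h']|/andP[h h']]; apply/or3P.
    - by constructor 1; apply: connect_trans cd.
    - by constructor 2; rewrite h; apply: connect_trans cd.
    - by constructor 3; rewrite h; apply: connect_trans cd.
  apply: (@bb_ind _ _ _ P) => [|z t k Pz|z k l Pz zT].
    by rewrite /P connect0.
    case/setU1P => [[/set2_eq zt ik]|zt]; last exact: tr (bb_edge T zt) Pz.
    rewrite {}ik in Pz *; move: Pz => /or3P[]; case: zt => -[-> ->];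
      rewrite -/X -/Y /P !connect0 ?andbT;
      by [move->; rewrite ?orbT | case/andP=> ->; rewrite ?orbT].
  exact: tr (bb_post _ _ _ zT) Pz.
have mono c' d' : connect (bb T w) c' d' ->
    connect (bb T (([set x; y], i) |: w)) c' d'.
  apply: (@bb_homo _ _ _ _ _ id) => [z t k zt|z k l]; last exact: bb_post.
  by apply: bb_edge; rewrite setU1r.
have XY : connect (bb T (([set x; y], i) |: w)) X Y.
  by apply: bb_edge; rewrite setU11.
have YX : connect (bb T (([set x; y], i) |: w)) Y X by rewrite bb_connect_sym.
case/or3P: c => [/mono//|/andP[/mono h /mono h']|/andP[/mono h /mono h']].
  exact: connect_trans h (connect_trans XY h').
exact: connect_trans h (connect_trans YX h').
Qed.

Lemma merge_labels_components T w L i j b :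
    (i < size vs)%N -> (j < size vs)%N -> labels_components T w L ->
  labels_components T ((edge (i, j), b) |: w)
                    (merge_labels L (i.*2 + b) (j.*2 + b)).
Proof.
move=> ik jk [sL cL]; split=> [|k l c d kk lk]; first by rewrite size_map.
have idx (r : nat) (f : bool) : (r < size vs)%N -> (r.*2 + f < size L)%N.
  by rewrite sL; case: f; lia.
rewrite /edge connect_bb_setU1 !cL // !(nth_map 0%N) ?idx //.
set lk' := nth _ _ (k.*2 + _); set ll := nth _ _ (l.*2 + _).
set li := nth _ _ (i.*2 + _); set lj := nth _ _ (j.*2 + _).
have [->|ki] := eqVneq lk' li; have [->|_] := eqVneq ll li;
  by rewrite ?eqxx /= ?(negPf ki) ?andbT ?andbF ?orbF.
Qed.

(** The two outcomes with exactly one copy of [e] have the same weight; grouping them yields the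
    three branches of [gap_check]. *)
Lemma ebexp_set1 p e (G : {set {set U} * bool} -> R) :
  ebexp [set e] p G =
    p e * p e * G [set (e, false); (e, true)] +
    p e * (1 - p e) * (G [set (e, false)] + G [set (e, true)]) +
    (1 - p e) * (1 - p e) * G set0.
Proof.
rewrite /ebexp.
have -> : setX [set e] [set: bool] = (e, false) |: ((e, true) |: set0).
  by apply/setP=> -[f []]; rewrite !inE !xpair_eqE !andbT ?andbF ?orbF.
rewrite !bexpU1 ?bexp0 ?inE ?xpair_eqE ?andbF //= !setU0.
by ring.
Qed.

(** [S] lists outcomes on the edges already treated, each as its set of present edges with its
    labelling. Expanding the next edge by [ebexp_set1] leaves nonnegative multiples of the three
    sums handled recursively; with no edge left, the sum is a difference of two counts. *)
Lemma gap_check_sound T p (l : seq (nat * nat))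
    (S : seq ({set {set U} * bool} * seq nat)) :
    (1 < size vs)%N ->
    {in l, forall e, (e.1 < size vs)%N && (e.2 < size vs)%N} ->
    uniq (map edge l) ->
    (forall e, 0 <= p e <= 1) ->
    (forall s, s \in S -> labels_components T s.1 s.2) ->
    gap_check l (map snd S) ->
  0 <= \sum_(s <- S) ebexp [set e in map edge l] p
         (fun w => gap R T (nth v0 vs 0) (nth v0 vs 1) (s.1 :|: w)).
Proof.
move=> k1; have k0 := ltnW k1; elim: l S => [|[i j] l IHl] S lk lu p01 SL.
  rewrite /= !count_map => le.
  have -> : \sum_(s <- S) ebexp [set e in [::]] p
      (fun w => gap R T (nth v0 vs 0) (nth v0 vs 1) (s.1 :|: w)) =
    (count (fun s => nth 0%N s.2 0 == nth 0%N s.2 2) S)%:R -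
    (count (fun s => nth 0%N s.2 0 == nth 0%N s.2 3) S)%:R.
    rewrite -!sum1_count !natr_sum.
    rewrite [X in X - _]big_mkcond [X in _ - X]big_mkcond -sumrB.
    apply: eq_big_seq => s /SL[_ cs] /=.
    have -> : [set e in [::]] = set0 :> {set {set U}}.
      by apply/setP=> e; rewrite !inE.
    rewrite /ebexp.
    have -> : setX set0 [set: bool] = set0 :> {set {set U} * bool}.
      by apply/setP=> -[e b]; rewrite !inE.
    rewrite bexp0 setU0 /gap !cs //=.
    by do 2!case: (_ == _).
  by rewrite subr_ge0 ler_nat.
have /andP[/= il jl] := lk (i, j) (mem_head _ _).
move: lu => /= /andP[el lu].
have {}lk : {in l, forall e, (e.1 < size vs)%N && (e.2 < size vs)%N}.
  by move=> e le; apply: lk; rewrite inE le orbT.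
case/and3P => C0 C2 C1.
set e := edge (i, j) in el *.
have -> : [set f in e :: map edge l] = [set e] :|: [set f in map edge l].
  by apply/setP=> f; rewrite !inE.
pose tot (S' : seq ({set {set U} * bool} * seq nat)) : R :=
  \sum_(s <- S') ebexp [set e in map edge l] p
         (fun w => gap R T (nth v0 vs 0) (nth v0 vs 1) (s.1 :|: w)).
pose m b (s : {set {set U} * bool} * seq nat) :=
  ((e, b) |: s.1, merge_labels s.2 (i.*2 + b) (j.*2 + b)).
have mS S' b : (forall s, s \in S' -> labels_components T s.1 s.2) ->
    forall s, s \in map (m b) S' -> labels_components T s.1 s.2.
  by move=> SL' _ /mapP[s /SL' sL ->]; apply: merge_labels_components.
have -> : \sum_(s <- S) ebexp ([set e] :|: [set f in map edge l]) p
      (fun w => gap R T (nth v0 vs 0) (nth v0 vs 1) (s.1 :|: w)) =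
    p e * p e * tot (map (m true) (map (m false) S)) +
    p e * (1 - p e) * tot (map (m false) S ++ map (m true) S) +
    (1 - p e) * (1 - p e) * tot S.
  rewrite /tot big_cat !big_map /= -big_split /= !mulr_sumr -!big_split /=.
  apply: eq_bigr => s _; rewrite ebexpU; last first.
    by rewrite disjoints_subset sub1set !inE.
  rewrite ebexp_set1; congr (_ * _ + _ * (_ + _) + _ * _);
    apply: eq_ebexp => w _; congr (gap _ _ _ _ _); apply/setP => f;
    by rewrite !inE; case: (f \in s.1); case: (f \in w); 
      case: (f == (e, false)); case: (f == (e, true)).
have /andP[p0 p1] := p01 e; have p1' : 0 <= 1 - p e by rewrite subr_ge0.
rewrite !addr_ge0 // mulr_ge0 ?mulr_ge0 //; apply: IHl => //.
- exact/mS/mS.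
- by rewrite -!map_comp in C2 *.
- by move=> s; rewrite mem_cat => /orP[]; apply: mS.
- by rewrite map_cat -!map_comp in C1 *.
Qed.
End FewVertices.

(** The graph is completed on [cover E] by edges of probability 0, which reduces it to the computed
    cases. *)
Lemma good_small (R : realType) (U : finType) (E : {set {set U}}) :
  (forall e, e \in E -> #|e| = 2) -> (#|cover E| <= 4)%N -> good R E.
Proof.
move=> E2 cE4; apply: good_cover => T p v u p01 vE uE vu.
(* [gap_check] expects the two endpoints as vertices 0 and 1. *)
pose vs := v :: u :: enum (cover E :\: [set v; u]).
have vs_uniq : uniq vs.
  rewrite /= !inE !mem_enum !inE !eqxx ?orbT (negPf vu) /=.
  exact: enum_uniq.
have svs : (2 <= size vs <= 4)%N.
  rewrite /= -cardE; have := cardsD (cover E) [set v; u].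
  have /setIidPr-> : [set v; u] \subset cover E.
    by rewrite subUset !sub1set vE uE.
  by rewrite cards2 vu; lia.
pose edge (e : nat * nat) := [set nth v vs e.1; nth v vs e.2].
pose E' := [set e in map edge (index_pairs (size vs))].
have sEE' : E \subset E'.
  apply/subsetP => e eE; rewrite inE.
  have /eqP/cards2P[a [b [ab De]]] := E2 e eE.
  have mem_vs x : x \in e -> x \in vs.
    move=> xe; rewrite !inE mem_enum !inE.
    have -> : x \in cover E by apply/bigcupP; exists e.
    by do 2!case: (_ == _).
  have avs : a \in vs by apply: mem_vs; rewrite De set21.
  have bvs : b \in vs by apply: mem_vs; rewrite De set22.
  have neq : index a vs != index b vs.
    by apply: contraNneq ab => eq; rewrite -(nth_index v avs) eq nth_index.
  apply/mapP; case: (ltngtP (index a vs) (index b vs)) neq => // lt _.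
    exists (index a vs, index b vs); rewrite ?mem_index_pairs ?lt ?index_mem //.
    by rewrite /edge /= !nth_index.
  exists (index b vs, index a vs); rewrite ?mem_index_pairs ?lt ?index_mem //.
  by rewrite /edge /= !nth_index // setUC.
pose p' e := if e \in E then p e else 0.
have -> : ebexp E p (gap R T v u) = ebexp E' p' (gap R T v u).
  rewrite /ebexp (@bexp_ext _ _ (setX E [set: bool]) (setX E' [set: bool])).
  - by apply: eq_bexp => // -[e b]; rewrite !inE andbT /p' => /= ->.
  - by apply: setXS.
  - by move=> -[e b]; rewrite !inE !andbT /p' => /andP[/negPf->].
have p'01 e : 0 <= p' e <= 1.
  by rewrite /p'; case: ifP => [/p01//|]; rewrite lexx ler01.
have eqn i j : (i < size vs)%N -> (j < size vs)%N ->
    nth v vs i = nth v vs j -> i = j.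
  by move=> si sj /eqP; rewrite nth_uniq // => /eqP.
have edges_uniq : uniq (map edge (index_pairs (size vs))).
  rewrite map_inj_in_uniq ?index_pairs_uniq // => -[i j] [k l].
  rewrite !mem_index_pairs => /andP[ij js] /andP[kl ls].
  have [is_ ks] := (ltn_trans ij js, ltn_trans kl ls).
  case/set2_eq => -[/= eq1 eq2].
    by rewrite (eqn _ _ is_ ks eq1) (eqn _ _ js ls eq2).
  have := eqn _ _ is_ ls eq1; have := eqn _ _ js ks eq2; lia.
have bounds : {in index_pairs (size vs), forall e,
    (e.1 < size vs)%N && (e.2 < size vs)%N}.
  move=> [i j]; rewrite mem_index_pairs => /andP[ij js].
  by rewrite (ltn_trans ij js).
have check :
    gap_check (index_pairs (size vs)) [:: post_labels [seq x \in T | x <- vs]].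
  by have := @gap_check_small [seq x \in T | x <- vs]; rewrite size_map; apply.
have labels s : s \in [:: (set0, post_labels [seq x \in T | x <- vs])] ->
    labels_components v vs T s.1 s.2.
  by rewrite inE => /eqP->; apply: post_labels_components.
have vs2 : (1 < size vs)%N by [].
have := gap_check_sound vs_uniq vs2 bounds edges_uniq p'01 labels check.
by rewrite big_seq1 (eq_ebexp _ (G' := gap R T v u)) // => w _; rewrite set0U.
Qed.

Local Close Scope ring_scope.

(** * Blocks *)

Section Blocks.
Variable U : finType.
Implicit Types (G H K : graph U) (E : {set {set U}}) (X : {set U}).

Lemma edge_card G e : e \in eset G -> #|e| = 2.
Proof. by move=> /(forall_inP (graph_wf G))/andP[_ /eqP]. Qed.

Lemma edge_sub G e : e \in eset G -> e \subset vset G.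
Proof. by move=> /(forall_inP (graph_wf G))/andP[]. Qed.

Lemma edge_other G e x : e \in eset G -> x \in e ->
  exists2 y, y != x & e = [set x; y].
Proof.
move=> /edge_card/eqP/cards2P[a [b [ab ->]]] /set2P[]->.
  by exists b; rewrite // eq_sym.
by exists a; rewrite // setUC.
Qed.

(* Covers both a cut vertex [c] and, when [c] is on no edge meeting [X],
   disconnectedness. *)
Definition separates E (c : U) X : bool :=
  [&& c \notin X,
      [forall e in E, [disjoint e & X] || (e \subset c |: X)],
      [exists e in E, [disjoint e & X]] &
      [exists e in E, ~~ [disjoint e & X]]].

(** Biconnectedness in terms of edges alone, so that edge sets can be split without tracking vertex
    sets. The empty set qualifies as well. *)
Definition inseparable E := forall c X, ~~ separates E c X.

(** A walk avoiding [c] cannot leave [X], yet an edge meeting [X] and an edge disjoint from it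
    supply two vertices that such a walk must join. *)
Lemma biconnected_inseparable K : biconnected K -> inseparable (eset K).
Proof.
case=> _ conK conD c X; apply/negP => /and4P[cX /forall_inP sep].
move=> /exists_inP[f fK fX] /exists_inP[e eK].
rewrite -setI_eq0 => /set0Pn[u /setIP[ue uX]].
have [y yf yc] : exists2 y, y \in f & y != c.
  have /eqP/cards2P[a [b [ab ->]]] := edge_card fK.
  have [ac|] := eqVneq a c; last by exists a; rewrite ?set21.
  by exists b; rewrite ?set22 // -ac eq_sym.
have yX : y \notin X by rewrite (disjointFr fX).
have [uK yK] : u \in vset K /\ y \in vset K.
  by split; [exact: (subsetP (edge_sub eK)) | exact: (subsetP (edge_sub fK))].
have uc : u != c by apply: contraNneq cX => <-.
have closed (e' : rel U) : (forall a b, e' a b -> adj K a b && (b != c)) ->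
    connect e' u y -> False.
  move=> e'K /(@connect_ind _ _ (fun a => a \in X)) H.
  move/negP: yX; apply; apply: H => // a b aX /e'K/andP[abK bc].
  case/orP: (sep _ abK) => [dX|/subsetP/(_ b)].
    by rewrite (disjointFr dX) ?set21 in aX.
  by rewrite set22 !inE (negPf bc); apply.
have [cK|cK] := boolP (c \in vset K).
  apply: (closed (adj (del_vertex K c))) => [a b|].
    rewrite /adj /= inE => /andP[-> cab] /=.
    by apply: contraNneq cab => <-; rewrite set22.
  by apply: conD => //; rewrite !inE ?uc ?yc.
apply: (closed (adj K)) => [a b abK|]; last exact: conK.
rewrite abK; apply: contraNneq cK => <-.
by apply: (subsetP (edge_sub abK)); rewrite set22.
Qed.

Fact edge_graph_wf G E : E \subset eset G ->
  [forall e in E, (e \subset cover E) && (#|e| == 2)].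
Proof.
move=> /subsetP EG; apply/forall_inP => e eE.
rewrite (edge_card (EG e eE)) eqxx andbT.
exact: bigcup_sup eE.
Qed.

Lemma inseparable_biconnected G E (EG : E \subset eset G) : E != set0 ->
  inseparable E -> biconnected (Graph (edge_graph_wf EG)).
Proof.
move=> /set0Pn[e0 e0E] insE; set H := Graph _.
have adj_sym x y : adj H x y = adj H y x by rewrite /adj setUC.
split=> [|x y /bigcupP[e eE xe] /bigcupP[f fE yf]|z zH x y].
- have <- : #|e0| = 2 by apply: edge_card (subsetP EG _ e0E).
  by apply: subset_leq_card; apply: bigcup_sup e0E.
(* If [x] does not reach [y], the component of [x] is separated, with the unreached [y] in the role
   of the cut vertex. *)
- apply/negPn/negP => xy; have /negP[] := insE y [set z | connect (adj H) x z].
  apply/and4P; split; first by rewrite inE.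
  + apply/forall_inP => g gE; have [|] := boolP [disjoint _ & _] => //=.
    rewrite -setI_eq0 => /set0Pn[a /setIP[ag]]; rewrite inE => xa.
    have [b _ Dg] := edge_other (gE : g \in eset H) ag.
    apply/subsetP => t; rewrite Dg !inE => /orP[]/eqP->.
      by rewrite xa orbT.
    apply/orP; right; apply: (connect_trans xa); apply: connect1.
    by rewrite /adj -Dg.
  + apply/exists_inP; exists f => //; rewrite -setI_eq0; apply/negPn/negP.
    move=> /set0Pn[a /setIP[af]]; rewrite inE => xa; case/negP: xy.
    have [-> //|ya] := eqVneq y a; apply: (connect_trans xa); apply: connect1.
    have [b _ Df] := edge_other (fE : f \in eset H) af.
    by move: yf; rewrite Df => /set2P[/eqP|->]; rewrite ?(negPf ya) // /adj -Df.
  + apply/exists_inP; exists e => //; rewrite -setI_eq0; apply/set0Pn.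
    by exists x; rewrite !inE xe connect0.
rewrite !inE => /andP[xz /bigcupP[e eE xe]] /andP[yz /bigcupP[f fE yf]].
set D := del_vertex H z; apply/negPn/negP => xy.
have DadjE a b : [set a; b] \in E -> a != z -> b != z -> adj D a b.
  by move=> abE az bz; rewrite /adj inE abE !inE negb_or !(eq_sym z) az.
have conz a : connect (adj D) x a -> a != z.
  apply: (@connect_ind _ _ (fun a => a != z)) => // b c bz.
  by rewrite /adj inE !inE negb_or (eq_sym z c) => /and3P[].
(* The same argument in the graph without [z], with [z] as a genuine cut vertex. *)
have /negP[] := insE z [set z | connect (adj D) x z].
apply/and4P; split; first by rewrite inE; apply: contraT => /negPn/conz/eqP.
+ apply/forall_inP => g gE; have [|] := boolP [disjoint _ & _] => //=.
  rewrite -setI_eq0 => /set0Pn[a /setIP[ag]]; rewrite inE => xa.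
  have [b _ Dg] := edge_other (gE : g \in eset H) ag.
  apply/subsetP => t; rewrite Dg !inE => /orP[]/eqP->; first by rewrite xa orbT.
  have [//|bz] := eqVneq b z; apply: (connect_trans xa); apply: connect1.
  by apply: DadjE (conz _ xa) bz; rewrite -Dg.
+ apply/exists_inP; exists f => //; rewrite -setI_eq0; apply/negPn/negP.
  move=> /set0Pn[a /setIP[af]]; rewrite inE => xa; case/negP: xy.
  have [-> //|ya] := eqVneq y a; apply: (connect_trans xa); apply: connect1.
  have [b _ Df] := edge_other (fE : f \in eset H) af.
  move: yf; rewrite Df => /set2P[/eqP|eqb]; first by rewrite (negPf ya).
  by rewrite eqb in yz *; apply: DadjE (conz _ xa) yz; rewrite -Df.
+ apply/exists_inP; exists e => //; rewrite -setI_eq0; apply/set0Pn.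
  by exists x; rewrite !inE xe connect0.
Qed.

Lemma connected_cover K :
  2 <= #|vset K| -> connected K -> vset K = cover (eset K).
Proof.
move=> K2 conK; apply/eqP; rewrite eqEsubset; apply/andP; split; last first.
  by apply/bigcupsP => e; apply: edge_sub.
apply/subsetP => x xK; have [y yK yx] : exists2 y, y \in vset K & y != x.
  move: K2; rewrite (cardsD1 x) xK ltnS => /card_gt0P[y].
  by rewrite !inE => /andP[]; exists y.
case/connectP: (conK x y xK yK) => -[|z s /= /andP[xz _ _]].
  by move=> _ eq; rewrite eq eqxx in yx.
by apply/bigcupP; exists [set x; z]; rewrite // set21.
Qed.

Lemma graph_eq H K : vset H = vset K -> eset H = eset K -> H = K.
Proof.
case: H K => vH eH wH [vK eK wK] /= eqv eqe; case: vK / eqv wK => wK.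
by case: eK / eqe wK => wK; congr Graph; apply: bool_irrelevance.
Qed.

Lemma inseparable_is_block G E (EG : E \subset eset G) : E != set0 ->
    inseparable E ->
    (forall K : {set {set U}}, K \subset eset G -> inseparable K ->
       K :&: E != set0 -> K \subset E) ->
  is_block G (Graph (edge_graph_wf EG)).
Proof.
move=> E0 insE maxE; split.
- rewrite /subgraph /= EG andbT; apply/bigcupsP => e /(subsetP EG).
  exact: edge_sub.
- exact: inseparable_biconnected.
move=> K /andP[_ KG] biK /andP[/= _ EK].
have KE : eset K \subset E.
  apply: maxE; rewrite ?(setIidPr EK) //.
  exact: biconnected_inseparable.
have eqE : eset K = E by apply/eqP; rewrite eqEsubset KE.
by case: biK => K2 conK _; apply: graph_eq; rewrite //= connected_cover // eqE.
Qed.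

(** Induction on the size of an edge set [E] containing every inseparable set that meets it. If [E]
    is inseparable and nonempty, it is the edge set of a block; otherwise a separation splits it
    into two smaller sets with the same closure property, glued at [c]. *)
Lemma good_of_blocks (R : realType) G :
    (forall H, is_block G H -> good R (eset H)) -> good R (eset G).
Proof.
move=> blk; suff IH E : E \subset eset G ->
    (forall K : {set {set U}}, K \subset eset G -> inseparable K ->
       K :&: E != set0 -> K \subset E) -> good R E.
  by apply: IH => // K KG _ _.
have [m] := ubnP #|E|; elim: m E => // m IHm E; rewrite ltnS => Em EG maxE.
have [->|E0] := eqVneq E set0.
  by apply: good_cover => T p v u _; rewrite /cover big_set0 inE.
have [/existsP[c /existsP[X sep]]|insE] :=
    boolP [exists c, exists X : {set U}, separates E c X]; last first.
  have {}insE : inseparable E.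
    move=> c X; apply: contra insE => sep.
    by apply/existsP; exists c; apply/existsP; exists X.
  exact: blk (inseparable_is_block EG E0 insE maxE).
have /and4P[cX /forall_inP sepE] := sep.
move=> /exists_inP[f fE fX] /exists_inP[e eE eX].
pose E1 := [set e in E | [disjoint e & X]].
pose E2 := [set e in E | ~~ [disjoint e & X]].
have DE : E = E1 :|: E2 by apply/setP => g; rewrite !inE -andb_orr orbN andbT.
have sub1 : E1 \subset E by apply/subsetP => g; rewrite inE => /andP[].
have sub2 : E2 \subset E by apply/subsetP => g; rewrite inE => /andP[].
(* An inseparable set with edges in both parts would itself be separated by [c] and [X]. *)
have side (K : {set {set U}}) : K \subset eset G -> inseparable K ->
    K :&: E != set0 -> K \subset E1 \/ K \subset E2.
  move=> KG insK KE; have /subsetP KE' := maxE K KG insK KE.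
  have := insK c X; rewrite /separates cX /=.
  have -> /= : [forall e in K, [disjoint e & X] || (e \subset c |: X)].
    by apply/forall_inP => g /KE'/sepE.
  rewrite negb_and => /orP[] none; [right|left]; apply/subsetP => g gK;
    rewrite inE KE' //=; apply: contraR none => gX;
    apply/exists_inP; exists g => //.
  by rewrite negbK in gX.
have lt1 : (#|E1| < m)%N.
  apply: (leq_trans _ Em); apply/proper_card/properP; split=> //.
  by exists e; rewrite // inE eE.
have lt2 : (#|E2| < m)%N.
  apply: (leq_trans _ Em); apply/proper_card/properP; split=> //.
  by exists f; rewrite // inE fE fX.
rewrite DE; apply: (@good_glue _ _ c (~: X) (c |: X)).
- apply/setP => x; rewrite !inE; have [->|] := eqVneq x c; first by rewrite cX.
  by case: (x \in X).
- by apply/setP => x; rewrite !inE; case: (x \in X); rewrite ?orbT.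
- by move=> g; rewrite inE disjoints_subset => /andP[].
- by move=> g; rewrite inE => /andP[/sepE/orP[->|]].
- rewrite disjoints_subset; apply/subsetP => g; rewrite !inE => /andP[-> ->].
  by [].
- apply: IHm => // [|K KG insK /set0Pn[g /setIP[gK g1]]].
    exact: subset_trans EG.
  have KE : K :&: E != set0.
    by apply/set0Pn; exists g; rewrite inE gK (subsetP sub1).
  have [//|/subsetP/(_ g gK)] := side K KG insK KE.
  by rewrite !inE in g1 *; case/andP: g1 => _ ->; rewrite andbF.
- apply: IHm => // [|K KG insK /set0Pn[g /setIP[gK g2]]].
    exact: subset_trans EG.
  have KE : K :&: E != set0.
    by apply/set0Pn; exists g; rewrite inE gK (subsetP sub2).
  have [/subsetP/(_ g gK)|//] := side K KG insK KE.
  by rewrite !inE in g2 *; case/andP: g2 => _ /negPf->; rewrite andbF.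
Qed.
End Blocks.

(** * Cycle blocks up to isomorphism, transfer to the percolation model, and conclusion *)

Lemma good_cycle_graph (R : realType) (U : finType) (H : graph U) :
  vset H = cover (eset H) -> is_cycle_graph H -> good R (eset H).
Proof.
move=> covH [n n3 [f [f_inj f_im f_adj]]].
have preim (i : 'I_n) : exists2 x, x \in vset H & f x = i.
  have : i \in f @: vset H by rewrite f_im inE.
  by case/imsetP=> x xH ->; exists x.
have [g gH gK] := fin_all_exists2 preim.
have fK x : x \in vset H -> g (f x) = x.
  by move=> xH; apply: f_inj; rewrite ?gK.
(* For [n >= 3] the filter in [cycle_graph] removes nothing. *)
have n_neq (i : 'I_n) : ordS i != i.
  rewrite -val_eqE /=; have := ltn_ord i; rewrite leq_eqVlt => /orP[/eqP eq|lt].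
    by rewrite eq modnn; lia.
  by rewrite modn_small //; lia.
have -> : eset H = [set [set g i; g (ordS i)] | i : 'I_n].
  apply/setP => e; apply/idP/imsetP => [eH|[i _ ->]].
    have /eqP/cards2P[a [b [ab De]]] := edge_card eH.
    have /subsetP eV := edge_sub eH.
    have aH : a \in vset H by rewrite eV // De set21.
    have bH : b \in vset H by rewrite eV // De set22.
    have : adj H a b by rewrite /adj -De.
    rewrite f_adj // => /imsetP[i _ /set2_eq[[fa fb]|[fa fb]]]; exists i => //.
      by rewrite De -(fK a aH) -(fK b bH) fa fb.
    by rewrite De -(fK a aH) -(fK b bH) fa fb setUC.
  suff : adj H (g i) (g (ordS i)) by [].
  by rewrite f_adj // !gK; apply/imsetP; exists i; rewrite ?inE.
exact: good_cycle (can_inj gK).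
Qed.

Lemma percolation_connect (U : finType) (G : graph U) (T : {set U})
    (w : {set {set U} * bool}) :
    T \subset vset G -> w \subset setX (eset G) [set: bool] ->
  connect (adj (percolation G T w)) =2 connect (bb T w).
Proof.
move=> /subsetP TG /subsetP wG a b; apply/idP/idP.
  apply: (@connect_homo _ _ _ _ id) => -[x i] [y j].
  rewrite /adj /= !in_setI !in_setU => /andP[_ /orP[]] /imsetP[].
    move=> [f k] fw /= Df.
    have : (x, i) \in hedge f k by rewrite -Df set21.
    case/imsetP=> x' _ [_ ->]; have : (y, j) \in hedge f k by rewrite -Df set22.
    case/imsetP=> y' _ [_ ->]; apply: bb_edge.
    have -> // : [set x; y] = f.
    have -> : [set x; y] = fst @: hedge f k by rewrite -Df imsetU1 imset_set1.
    by rewrite -imset_comp imset_id.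
  by move=> v vT /set2_eq[] [[-> ->] [-> ->]]; apply: bb_post.
apply: (@bb_homo _ _ _ _ _ id) => [x y i xyw|x i j xT].
  apply: connect1; rewrite /adj /= !inE.
  have De : [set (x, i); (y, i)] = hedge [set x; y] i.
    by rewrite /hedge imsetU1 imset_set1.
  apply/andP; split; apply/orP; left; rewrite De.
    apply/imset2P; exists [set x; y] i; rewrite ?inE //.
    by have := wG _ xyw; rewrite !inE andbT.
  by apply/imsetP; exists ([set x; y], i).
(* Equal levels give the loop that [bb] allows at a post, which is not an edge of the bunkbed
   graph. *)
have [->|ij] := eqVneq i j; first exact: connect0.
apply: connect1; rewrite /adj /= !inE.
have De : [set (x, i); (x, j)] = post x.
  by case: i j ij => [] [] // _; rewrite // setUC.
apply/andP; split; apply/orP; right; rewrite De.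
  by apply: imset_f; apply: TG.
exact: imset_f.
Qed.

Lemma prob_ebexp (R : realType) (U : finType) (G : graph U) (p : {set U} -> R)
    (A : pred {set {set U} * bool}) :
  prob G p A = ebexp (eset G) p (fun w => (A w)%:R%R).
Proof.
rewrite /prob big_mkcondr; apply: eq_bigr => w _.
by rewrite mulrb; case: (A w); rewrite ?mulr1 ?mulr0.
Qed.

Theorem theorem11 (R : realType) (U : finType) (G : graph U)
    (hG : forall H : graph U, is_block G H ->
            is_cycle_graph H \/ #|vset H| <= 4) :
  strong_bunkbed R G.
Proof.
have good_G : good R (eset G).
  apply: good_of_blocks => H blkH; have [_ [H2 conH _] _] := blkH.
  have covH := connected_cover H2 conH.
  case: (hG H blkH) => [|H4]; first exact: good_cycle_graph.
  by apply: good_small => [e|]; [apply: edge_card | rewrite -covH].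
move=> T p v u TG p01 _ _; rewrite /bunkbed_ineq !prob_ebexp -subr_ge0 -bexpB.
apply: le_trans (good_G T p v u p01) _; rewrite le_eqVlt; apply/orP; left.
by apply/eqP/eq_ebexp => w wG; rewrite /gap !percolation_connect.
Qed.
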